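(* Let $G$ be a locally compact group, let $B$ be a unital C$^*$-algebra, and let $(\mathcal{B},G,\pi)$ be the trivial Banach bundle over $G$ whose constant fiber is the Banach space underlying $B$, i.e. $\mathcal{B}=G\times B$ with the product topology and $\pi$ the projection onto $G$. Let $(S,\omega)\in C^1_c(G,\operatorname{Aut}(B))\times C^2_c(G,UB)$ satisfy (C1) $S(g)(S(h)(b))\,\omega(g,h)=\omega(g,h)\,S(gh)(b)$ for all $g,h\in G$ and $b\in B$, and (C2) $S(g)(\omega(h,k))\,\omega(g,hk)=\omega(g,h)\,\omega(gh,k)$ for all $g,h,k\in G$. Then $(\mathcal{B},G,\pi)$ together with the multiplication and involution $$(g,b)\,(h,c):=\big(gh,\;b\,S(g)(c)\,\omega(g,h)\big),\qquad(g,b)^*:=\big(g^{-1},\;\omega(g^{-1},g)^*\,S(g^{-1})(b^* )\big)\qquad(g,h\in G,\ b,c\in B)$$ is a crossed product bundle.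
   Context: All topological spaces are Hausdorff. $UB$ is the group of unitaries of $B$ (norm topology). $C^1_c(G,\operatorname{Aut}(B))$ is the set of strongly continuous maps $S:G\to\operatorname{Aut}(B)$ (i.e. $g\mapsto S(g)(b)$ is norm continuous for each $b\in B$) with $S(e)=\operatorname{id}_B$; $C^2_c(G,UB)$ is the set of continuous maps $\omega:G\times G\to UB$ with $\omega(g,e)=\omega(e,g)=1_B$ for all $g\in G$. A Banach bundle $(\mathcal{B},X,\pi)$ consists of a topological space $\mathcal{B}$, a locally compact space $X$ and a continuous open surjection $\pi:\mathcal{B}\to X$ whose fibers $B_x=\pi^{-1}(x)$ are complex Banach spaces, such that: $s\mapsto\|s\|$ is continuous; $(s,t)\mapsto s+t$ is continuous on $\{(s,t):\pi(s)=\pi(t)\}$; $s\mapsto\lambda s$ is continuous for each $\lambda\in\mathbb{C}$; and if $(s_i)$ is a net with $\|s_i\|\to0$ and $\pi(s_i)\to x$, then $s_i\to0_x$. A Fell bundle is a Banach bundle $(\mathcal{B},G,\pi)$ over a locally compact group with a continuous associative multiplication and a continuous involution such that: $B_gB_h\subseteq B_{gh}$, bilinearly; $\|st\|\le\|s\|\|t\|$; $B_g^*\subseteq B_{g^{-1}}$, antilinearly; $(st)^*=t^*s^*$; $(s^* )^*=s$; $\|s^*s\|=\|s\|^2$; $s^*s\ge0$ in the C$^*$-algebra $B_e$. A Fell bundle with unital unit fiber $B_e$ is a crossed product bundle if each fiber $B_g$ contains a unitary element, i.e. an element $u_g\in B_g$ with $u_gu_g^*=u_g^*u_g=1_{B_e}$.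 *)

(* Defs.v *)
From HB Require Import structures.
From mathcomp Require Import all_boot all_order all_algebra.
From mathcomp Require Import all_classical all_reals.
From mathcomp Require Import topology normedtype.
From mathcomp Require Import complex.

Set Implicit Arguments.
Unset Strict Implicit.
Unset Printing Implicit Defensive.

Import Order.TTheory GRing.Theory Num.Theory.
Import numFieldNormedType.Exports.

Local Open Scope classical_set_scope.
Local Open Scope ring_scope.
Local Open Scope complex_scope.

HB.mixin Record isTopologicalGroup G & Topological G & Group G := {
  mulg_continuous : continuous (fun p : G * G => (p.1 * p.2)%g);
  invg_continuous : continuous (fun x : G => (x^-1)%g)
}.

#[short(type="topologicalGroupType")]
HB.structure Definition TopologicalGroup :=
  {G of Topological G & Group G & isTopologicalGroup G}.

(* This is a plain record: a Hierarchy-Builder structure that is at once normed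
   over R[i] and a ring is rejected, because numDomainType (normed over itself)
   is not below it. The zero algebra is allowed, unlike in algType. *)
Record unitalCstarAlgType (R : realType) := UnitalCstarAlg {
  cstar_banach : completeNormedModType R[i];
  cstar_one : cstar_banach;
  cstar_mul : cstar_banach -> cstar_banach -> cstar_banach;
  cstar_star : cstar_banach -> cstar_banach;
  cstar_mulA : associative cstar_mul;
  cstar_mul1l : left_id cstar_one cstar_mul;
  cstar_mul1r : right_id cstar_one cstar_mul;
  cstar_mulDl : left_distributive cstar_mul +%R;
  cstar_mulDr : right_distributive cstar_mul +%R;
  cstar_scaleAl : forall (a : R[i]) x y,
    a *: cstar_mul x y = cstar_mul (a *: x) y;
  cstar_scaleAr : forall (a : R[i]) x y,
    a *: cstar_mul x y = cstar_mul x (a *: y);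
  cstar_norm_mul : forall x y, `|cstar_mul x y| <= `|x| * `|y|;
  cstar_starK : involutive cstar_star;
  cstar_starD : {morph cstar_star : x y / x + y};
  cstar_starZ : forall (a : R[i]) x,
    cstar_star (a *: x) = conjc a *: cstar_star x;
  cstar_starM : forall x y,
    cstar_star (cstar_mul x y) = cstar_mul (cstar_star y) (cstar_star x);
  cstar_norm_star_mul : forall x, `|cstar_mul (cstar_star x) x| = `|x| ^+ 2
}.

Definition cstar_sort (R : realType) (B : unitalCstarAlgType R) : Type :=
  cstar_banach B.
Coercion cstar_sort : unitalCstarAlgType >-> Sortclass.

Section CstarAlgebra.
Variables (R : realType) (B : unitalCstarAlgType R).

HB.instance Definition _ := CompleteNormedModule.on (cstar_sort B).

HB.instance Definition _ := GRing.Zmodule_isPzRing.Build (cstar_sort B)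
  (@cstar_mulA R B) (@cstar_mul1l R B) (@cstar_mul1r R B)
  (@cstar_mulDl R B) (@cstar_mulDr R B).

Definition star (x : B) : B := cstar_star x.

End CstarAlgebra.

Section Cocycles.
Variables (R : realType) (G : topologicalGroupType) (B : unitalCstarAlgType R).

Definition unitary (u : B) : Prop := u * star u = 1 /\ star u * u = 1.

Record is_star_automorphism (f : B -> B) : Prop := {
  aut_bij : bijective f;
  aut_linear : linear f;
  aut_mul : monoid_morphism f;
  aut_star : {morph f : x / star x}
}.

(* C^1_c(G, Aut B) *)
Record cochain1 (S : G -> B -> B) : Prop := {
  cochain1_aut : forall g, is_star_automorphism (S g);
  cochain1_continuous : forall b, continuous (fun g => S g b);
  cochain1_one : forall b, S 1%g b = b
}.

(* C^2_c(G, UB) *)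
Record cochain2 (omega : G -> G -> B) : Prop := {
  cochain2_unitary : forall g h, unitary (omega g h);
  cochain2_continuous : continuous (fun p : G * G => omega p.1 p.2);
  cochain2_oner : forall g, omega g 1%g = 1;
  cochain2_onel : forall g, omega 1%g g = 1
}.

End Cocycles.

(* The fiberwise structure is carried by functions on the total space; fadd s t
   is meaningful only when s and t lie over the same point, and fzero x is the
   zero vector of the fiber over x. *)
Record bundle (R : realType) (X : topologicalType) := Bundle {
  btotal :> topologicalType;
  bproj : btotal -> X;
  fzero : X -> btotal;
  fadd : btotal -> btotal -> btotal;
  fscale : R[i] -> btotal -> btotal;
  fnorm : btotal -> R
}.

Arguments bproj {R X b} _.
Arguments fzero {R X} b _.
Arguments fadd {R X b} _ _.
Arguments fscale {R X b} _ _.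
Arguments fnorm {R X b} _.

Section BanachBundle.
Variables (R : realType) (X : topologicalType) (E : bundle R X).

Definition fiber (x : X) : set E := [set s | bproj s = x].

(* The operations of E make the fiber over x a complex Banach space: it is the
   bijective image of one, with the operations and the norm transported.
   Norms in a normedModType R[i] take values in R[i], whence %:C. *)
Definition banach_fiber (x : X) : Prop :=
  exists (V : completeNormedModType R[i]) (j : V -> E),
    [/\ set_bij [set: V] (fiber x) j,
        j 0 = fzero E x,
        forall u v, j (u + v) = fadd (j u) (j v),
        forall a u, j (a *: u) = fscale a (j u)
      & forall u, (fnorm (j u))%:C = `|u| ].

(* In the last axiom nets are rendered by filtered families. *)
Record is_banach_bundle : Prop := {
  total_hausdorff : hausdorff_space E;
  base_hausdorff : hausdorff_space X;
  base_locally_compact : locally_compact [set: X];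
  bproj_continuous : continuous (bproj : E -> X);
  bproj_open : forall U : set E, open U -> open ((bproj : E -> X) @` U);
  bproj_surj : forall x : X, exists s : E, bproj s = x;
  fiber_banach : forall x, banach_fiber x;
  fnorm_continuous : continuous (fnorm : E -> R);
  fadd_continuous : {within [set p : E * E | bproj p.1 = bproj p.2],
                      continuous (fun p : E * E => fadd p.1 p.2)};
  fscale_continuous : forall a, continuous (fscale a : E -> E);
  fzero_cvg : forall (I : Type) (F : set_system I) (s : I -> E) (x : X),
    ProperFilter F ->
    fnorm (s i) @[i --> F] --> (0 : R) -> bproj (s i) @[i --> F] --> x ->
    s i @[i --> F] --> fzero E x
}.

End BanachBundle.

Section FellBundle.
Variables (R : realType) (G : topologicalGroupType) (E : bundle R G).
Variables (mul : E -> E -> E) (inv : E -> E).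

(* Positivity in the C*-algebra B_e: the positive elements of a C*-algebra are
   those of the form c^* c. *)
Definition fiber1_pos (a : E) : Prop :=
  exists2 c : E, fiber (1%g : G) c & a = mul (inv c) c.

Record is_fell_bundle : Prop := {
  fell_banach : is_banach_bundle E;
  fell_mul_continuous : continuous (fun p : E * E => mul p.1 p.2);
  fell_mulA : associative mul;
  fell_inv_continuous : continuous inv;
  fell_proj_mul : forall s t, bproj (mul s t) = (bproj s * bproj t)%g;
  fell_mulDl : forall s s' t, bproj s = bproj s' ->
    mul (fadd s s') t = fadd (mul s t) (mul s' t);
  fell_mulDr : forall s t t', bproj t = bproj t' ->
    mul s (fadd t t') = fadd (mul s t) (mul s t');
  fell_mulZl : forall a s t, mul (fscale a s) t = fscale a (mul s t);
  fell_mulZr : forall a s t, mul s (fscale a t) = fscale a (mul s t);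
  fell_norm_mul : forall s t, fnorm (mul s t) <= fnorm s * fnorm t;
  fell_proj_inv : forall s, bproj (inv s) = (bproj s)^-1%g;
  fell_invD : forall s t, bproj s = bproj t ->
    inv (fadd s t) = fadd (inv s) (inv t);
  fell_invZ : forall a s, inv (fscale a s) = fscale (conjc a) (inv s);
  fell_invM : forall s t, inv (mul s t) = mul (inv t) (inv s);
  fell_invK : involutive inv;
  fell_norm_inv_mul : forall s, fnorm (mul (inv s) s) = fnorm s ^+ 2;
  fell_pos : forall s, fiber1_pos (mul (inv s) s)
}.

Definition is_fiber1_unit (u : E) : Prop :=
  fiber (1%g : G) u /\
  forall s, fiber (1%g : G) s -> mul u s = s /\ mul s u = s.

Definition is_crossed_product_bundle : Prop :=
  is_fell_bundle /\
  exists2 one : E, is_fiber1_unit one &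
    forall g : G, exists2 u : E, fiber g u &
      mul u (inv u) = one /\ mul (inv u) u = one.

End FellBundle.

Section TwistedBundle.
Variables (R : realType) (G : topologicalGroupType) (B : unitalCstarAlgType R).

(* complex.Re converts the R[i]-valued norm of B into a real number. *)
Definition trivial_bundle : bundle R G :=
  @Bundle R G (G * B)%type fst
    (fun g => (g, 0))
    (fun p q => (p.1, p.2 + q.2))
    (fun a p => (p.1, a *: p.2))
    (fun p => complex.Re `|p.2|).

Variables (S : G -> B -> B) (omega : G -> G -> B).

Definition twisted_mul (p q : trivial_bundle) : trivial_bundle :=
  ((p.1 * q.1)%g, p.2 * S p.1 q.2 * omega p.1 q.1).

Definition twisted_inv (p : trivial_bundle) : trivial_bundle :=
  ((p.1^-1)%g, star (omega (p.1^-1)%g p.1) * S (p.1^-1)%g (star p.2)).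

End TwistedBundle.

(* Main.v *)
Require Import Defs.
From HB Require Import structures.
From mathcomp Require Import all_boot all_order all_algebra.
From mathcomp Require Import all_classical all_reals.
From mathcomp Require Import topology normedtype.
From mathcomp Require Import sequences complex lra.

Import Order.TTheory GRing.Theory Num.Theory.
Import numFieldNormedType.Exports.

Local Open Scope classical_set_scope.
Local Open Scope ring_scope.
Local Open Scope complex_scope.

(** Almost all of the Fell bundle axioms are algebra in the cocycle identities;
    the analytic content is that each [S g] is isometric.  The joint continuity
    of [(g, c) |-> S g c], the submultiplicativity of the norm and the
    C*-identity of the bundle all reduce to that fact, because the unitaries
    [omega g h] do not change norms either.

    That a *-automorphism is isometric follows once every unital *-morphism [f]
    is contractive, and this is proved here without spectral theory.  By the
    C*-identity it suffices to bound [f a] for [a] self-adjoint of norm less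
    than [1].  Then [1 - a ^+ 2] has a self-adjoint square root [c] commuting
    with [a] (lemma [cstar_complement_sqrt]), so that [f a + i (f c)] is an
    isometry of norm at most [1]; [f a] is the mean of this element and its
    adjoint, hence has norm at most [1].  The square root is [1 - y], where [y]
    is the fixed point of the contraction [y |-> (a ^+ 2 + y ^+ 2) / 2] of a
    ball of radius less than [1].

    For the algebra, put [u g = (g, 1)] and embed [B] as the fiber over the unit
    by [b |-> (1, b)].  Every element is [(g, b) = b u_g], and (C1), (C2) amount
    to the commutation rules [u_g b = S_g(b) u_g] and
    [u_g u_h = omega(g, h) u_{gh}] in an associative product.  The element
    [u_g^*] is the inverse of [u_g], and [(b u_g)^* = u_g^* b^*], so that the
    antimultiplicativity of the involution (lemma [twisted_invM]) comes from
    inverting the second rule.  The same [u_g] are the unitaries required in a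
    crossed product bundle. *)

(** * Complex normed modules with a real-valued norm *)

Section RealNorm.
Context {R : realType} {V : normedModType R[i]}.
Implicit Types x y : V.

(** The norm of [V] takes its values in [R[i]], where the order is only
    partial; real values give access to [lra] and to squeezing. *)
Definition rnorm x : R := complex.Re `|x|.

Lemma rnormE x : (rnorm x)%:C = `|x|.
Proof. by rewrite /rnorm RRe_real// normr_real. Qed.

Lemma rnorm_ge0 x : 0 <= rnorm x.
Proof. by rewrite -lecR rnormE normr_ge0. Qed.

Lemma rnorm0 : rnorm (0 : V) = 0.
Proof. by rewrite /rnorm normr0. Qed.

Lemma rnormN x : rnorm (- x) = rnorm x.
Proof. by rewrite /rnorm normrN. Qed.

Lemma rnormC x y : rnorm (x - y) = rnorm (y - x).
Proof. by rewrite -rnormN opprB. Qed.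

Lemma ler_rnormD x y : rnorm (x + y) <= rnorm x + rnorm y.
Proof. by rewrite -lecR rmorphD/= !rnormE ler_normD. Qed.

Lemma ler_rnorm_dist x y z : rnorm (x - z) <= rnorm (x - y) + rnorm (y - z).
Proof. by rewrite -(subrKA y x (- z)) ler_rnormD. Qed.

Lemma rnormZ (a : R[i]) x : rnorm (a *: x) = complex.Re `|a| * rnorm x.
Proof.
apply: complexI; rewrite rmorphM/= !rnormE normrZ.
by rewrite (RRe_real (normr_real a)).
Qed.

Lemma rnormZr (a : R) x : 0 <= a -> rnorm (a%:C *: x) = a * rnorm x.
Proof. by move=> a0; rewrite rnormZ ger0_norm// lecR. Qed.

(** Real radii describe all neighborhoods, because [0 < e] in [R[i]] forces [e]
    to be real. *)
Lemma cvg_rnormP {T : Type} {F : set_system T} {FF : Filter F} (f : T -> V) y :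
  f t @[t --> F] --> y <->
  forall e : R, 0 < e -> \forall t \near F, rnorm (y - f t) < e.
Proof.
split=> [/cvgrPdist_lt fy e e0|fy].
  have /fy : 0 < e%:C :> R[i] by rewrite ltcR.
  by apply: filterS => t; rewrite -rnormE ltcR.
apply/cvgrPdist_lt => e e0.
have eE : (complex.Re e)%:C = e by rewrite RRe_real// gtr0_real.
have /fy : 0 < complex.Re e by rewrite -ltcR eE.
by apply: filterS => t; rewrite -eE -rnormE ltcR.
Qed.

Lemma cvg_rnorm0P {T : Type} {F : set_system T} {FF : Filter F} (f : T -> V) y :
  f t @[t --> F] --> y <-> rnorm (y - f t) @[t --> F] --> (0 : R).
Proof.
rewrite cvg_rnormP; split=> [fy|/cvgrPdist_lt fy e /fy].
  by apply/cvgrPdist_lt => e /fy; apply: filterS => t;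
    rewrite sub0r normrN ger0_norm ?rnorm_ge0.
by apply: filterS => t; rewrite sub0r normrN ger0_norm ?rnorm_ge0.
Qed.

Lemma rnorm_continuous : continuous (rnorm : V -> R).
Proof.
move=> x; apply/cvgrPdist_lt => e e0.
have /cvg_rnormP/(_ e e0) : y @[y --> x] --> x by [].
apply: filterS => y; apply: le_lt_trans.
rewrite ler_norml; have := ler_rnorm_dist x y 0; have := ler_rnorm_dist y x 0.
by rewrite !subr0 (rnormC y x); lra.
Qed.

End RealNorm.

Lemma lipschitz_continuous {R : realType} {V W : normedModType R[i]} (k : R)
  (f : V -> W) :
  0 <= k ->
  (forall x y, rnorm (f x - f y) <= k * rnorm (x - y)) -> continuous f.
Proof.
move=> k0 fk x; apply/cvg_rnorm0P.
apply: (@squeeze_cvgr _ _ _ _ (fun=> 0) (fun y => k * rnorm (x - y))).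
- by near=> y; rewrite rnorm_ge0 fk.
- exact: cvg_cst.
- rewrite -(mulr0 k); apply: cvgM; first exact: cvg_cst.
  exact/cvg_rnorm0P.
Unshelve. all: by end_near. Qed.

(** Banach's fixed point theorem over the scalars [R[i]].  The bound [dist] on
    the iterates is telescoping, so that they form a Cauchy sequence. *)
Lemma contraction_fixed_point {R : realType} {V : completeNormedModType R[i]}
  (A : set V) (f : V -> V) (q : R) :
  closed A -> A !=set0 -> (forall x, A x -> A (f x)) -> 0 <= q < 1 ->
  (forall x y, A x -> A y -> rnorm (f x - f y) <= q * rnorm (x - y)) ->
  exists2 p, A p & f p = p.
Proof.
move=> clA [x0 Ax0] fA /andP[q0 q1] fq.
pose u n := iter n f x0.
have Au n : A (u n) by elim: n => //= n; exact: fA.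
(* [C * q ^+ n] is the tail of the geometric series bounding the increments. *)
pose C := rnorm (f x0 - x0) / (1 - q).
have C0 : 0 <= C by rewrite divr_ge0 ?rnorm_ge0// subr_ge0 ltW.
have CE : rnorm (f x0 - x0) = C * (1 - q).
  by rewrite /C divfK// subr_eq0 gt_eqF.
have step n : rnorm (u n.+1 - u n) <= C * (q ^+ n - q ^+ n.+1).
  elim: n => [|n IH]; first by rewrite expr0 expr1 /= CE.
  apply: le_trans (fq _ _ (Au n.+1) (Au n)) _.
  by apply: le_trans (ler_wpM2l q0 IH) _; rewrite !exprS; lra.
have dist n m : rnorm (u (n + m)%N - u n) <= C * (q ^+ n - q ^+ (n + m)).
  elim: m => [|m IH]; first by rewrite addn0 !subrr rnorm0 mulr0.
  rewrite addnS; apply: le_trans (ler_rnorm_dist _ (u (n + m)%N) _) _.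
  by have := step (n + m)%N; move: IH; lra.
have Cq0 : C * q ^+ n @[n --> \oo] --> 0.
  by apply: cvg_geometric; rewrite ger0_norm.
have Cqlt (e : R) : 0 < e -> \forall n \near \oo, C * q ^+ n < e.
  move=> e0; move/cvgrPdist_lt: Cq0 => /(_ e e0).
  apply: filterS => n; rewrite sub0r normrN; apply: le_lt_trans.
  exact: ler_norm.
have /cauchy_cvgP/cvg_ex[p up] : cauchy (u n @[n --> \oo]).
  apply/cauchy_exP => e e0.
  have eE : (complex.Re e)%:C = e by rewrite RRe_real// gtr0_real.
  have /Cqlt[N _ NP] : 0 < complex.Re e by rewrite -ltcR eE.
  exists (u N); exists N => // n /= Nn.
  rewrite -ball_normE /= -eE -rnormE ltcR rnormC -(subnKC Nn).
  apply: le_lt_trans (dist _ _) (le_lt_trans _ (NP N (leqnn _))).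
  by rewrite ler_wpM2l// gerBl exprn_ge0.
have Ap : A p.
  by apply: (closed_cvg A clA _ p up); apply: nearW; exact: Au.
exists p => //.
have fup : u n.+1 @[n --> \oo] --> f p.
  apply/cvg_rnormP => e e0; move/cvg_rnormP: up => /(_ e e0).
  apply: filterS => n; apply: le_lt_trans.
  apply: le_trans (fq _ _ Ap (Au n)) _.
  by rewrite ler_piMl ?rnorm_ge0// ltW.
rewrite (cvg_shiftS u) in fup.
exact: cvg_unique (@norm_hausdorff _ V) _ _ _ _ fup up.
Qed.

(** * C*-algebras *)

Section CstarAlgebra.
Context {R : realType} {B : unitalCstarAlgType R}.
Implicit Types x y a b : B.

Lemma scale_mulAl (k : R[i]) x y : k *: (x * y) = (k *: x) * y.
Proof. exact: cstar_scaleAl. Qed.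

Lemma scale_mulAr (k : R[i]) x y : k *: (x * y) = x * (k *: y).
Proof. exact: cstar_scaleAr. Qed.

Lemma starK x : star (star x) = x. Proof. exact: cstar_starK. Qed.

Lemma starM x y : star (x * y) = star y * star x.
Proof. exact: cstar_starM. Qed.

Lemma starD x y : star (x + y) = star x + star y.
Proof. exact: cstar_starD. Qed.

Lemma starZ (k : R[i]) x : star (k *: x) = conjc k *: star x.
Proof. exact: cstar_starZ. Qed.

Lemma starN x : star (- x) = - star x.
Proof. by rewrite -scaleN1r starZ rmorphN1 scaleN1r. Qed.

Lemma starB x y : star (x - y) = star x - star y.
Proof. by rewrite starD starN. Qed.

Lemma star0 : star (0 : B) = 0.
Proof. by rewrite -(subrr (0 : B)) starB !subrr. Qed.

Lemma star1 : star (1 : B) = 1.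
Proof. by rewrite -[LHS]mulr1 -{2}[1]starK -starM mulr1 starK. Qed.

Lemma rnormM x y : rnorm (x * y) <= rnorm x * rnorm y.
Proof. by rewrite -lecR rmorphM/= !rnormE; exact: cstar_norm_mul. Qed.

Lemma rnorm_star_mul x : rnorm (star x * x) = rnorm x ^+ 2.
Proof.
by apply: complexI; rewrite rmorphXn/= !rnormE; exact: cstar_norm_star_mul.
Qed.

(** From [rnorm x ^+ 2 = rnorm (star x * x) <= rnorm (star x) * rnorm x]. *)
Lemma ler_rnorm_star x : rnorm x <= rnorm (star x).
Proof.
have := rnorm_ge0 x; rewrite le_eqVlt => /predU1P[<-|x0].
  exact: rnorm_ge0.
by rewrite -(ler_pM2r x0) -expr2 -rnorm_star_mul rnormM.
Qed.

Lemma rnorm_star x : rnorm (star x) = rnorm x.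
Proof.
by apply/le_anti; rewrite ler_rnorm_star -{2}[x]starK ler_rnorm_star.
Qed.

(** The bound is not an equality, since [1] has norm [0] in the zero algebra. *)
Lemma rnorm_isometry_le1 (u : B) : star u * u = 1 -> rnorm u <= 1.
Proof.
move=> uu.
have n1 : rnorm (1 : B) = rnorm (1 : B) ^+ 2.
  by rewrite -rnorm_star_mul star1 mulr1.
have u2 : rnorm u ^+ 2 = rnorm (1 : B) by rewrite -rnorm_star_mul uu.
have n_le1 : rnorm (1 : B) <= 1 by have := rnorm_ge0 (1 : B); nra.
by rewrite -(@expr_le1 _ 2) ?rnorm_ge0// u2.
Qed.

Lemma rnorm_unitary_le1 (u : B) : unitary u -> rnorm u <= 1.
Proof. by move=> [_ /rnorm_isometry_le1]. Qed.

Lemma unitary_star (u : B) : unitary u -> unitary (star u).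
Proof. by move=> [uu' u'u]; split; rewrite starK. Qed.

Lemma rnorm_mul_unitary x (u : B) : unitary u -> rnorm (x * u) = rnorm x.
Proof.
move=> uU; apply/le_anti/andP; split.
  apply: le_trans (rnormM _ _) _.
  by rewrite ler_piMr ?rnorm_ge0 ?rnorm_unitary_le1.
have [uu' _] := uU; rewrite -{1}[x]mulr1 -uu' mulrA.
apply: le_trans (rnormM _ _) _.
by rewrite ler_piMr ?rnorm_ge0// rnorm_unitary_le1//; exact: unitary_star.
Qed.

Lemma star_continuous : continuous (@star R B).
Proof.
apply: (@lipschitz_continuous _ _ _ 1) => // x y.
by rewrite mul1r -starB rnorm_star.
Qed.

Lemma cstar_cvgM {T : Type} {F : set_system T} {FF : Filter F}
  (f g : T -> B) a b :
  f t @[t --> F] --> a -> g t @[t --> F] --> b ->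
  f t * g t @[t --> F] --> a * b.
Proof.
move=> fa gb; apply/cvg_rnorm0P.
apply: (@squeeze_cvgr _ _ _ _ (fun=> 0) (fun t =>
  rnorm (a - f t) * rnorm (g t) + rnorm a * rnorm (b - g t))).
- near=> t; rewrite rnorm_ge0/=.
  apply: le_trans (lerD (rnormM _ _) (rnormM _ _)).
  apply: le_trans (ler_rnormD _ _).
  by rewrite mulrBr mulrBl [X in _ <= rnorm X]addrC subrKA.
- exact: cvg_cst.
- rewrite -[0](addr0 0) -[X in X + _](mul0r (rnorm b)).
  rewrite -[X in _ + X](mulr0 (rnorm a)).
  apply: cvgD; apply: cvgM;
    [exact/cvg_rnorm0P| |exact: cvg_cst|exact/cvg_rnorm0P].
  exact: (cvg_comp _ _ gb (rnorm_continuous b)).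
Unshelve. all: by end_near. Qed.

(** If [y = (a ^+ 2 + y ^+ 2) / 2] then [(1 - y) ^+ 2 = 1 - a ^+ 2].  On the
    closed ball of radius [r = rnorm a ^+ 2 < 1] the right-hand side is a
    contraction of ratio [r]; it also preserves the closed set of self-adjoint
    elements commuting with [a], so that its fixed point lies there. *)
Lemma cstar_complement_sqrt a : star a = a -> rnorm a < 1 ->
  exists c : B, [/\ star c = c, a * c = c * a & a * a + c * c = 1].
Proof.
move=> aa a1.
pose r := rnorm a ^+ 2.
have r01 : 0 <= r < 1 by rewrite /r exprn_ge0 ?rnorm_ge0// expr_lt1 ?rnorm_ge0.
have ra : rnorm (a * a) = r by rewrite -{1}aa rnorm_star_mul.
pose A := [set y : B | rnorm y <= r] `&`
  ([set y : B | star y - y = 0] `&` [set y : B | a * y - y * a = 0]).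
pose h : R := 2^-1.
pose f (y : B) := h%:C *: (a * a + y * y).
have h0 : 0 <= h by rewrite /h invr_ge0.
have AP y : A y -> [/\ rnorm y <= r, star y = y & a * y = y * a].
  by move=> [? [/= /eqP + /eqP]]; rewrite !subr_eq0 => /eqP ? /eqP ?.
have closed0 (k : B -> B) : continuous k -> closed [set y | k y = 0].
  move=> ck; apply: (@preimage_closed _ _ k [set 0]) => //.
  exact/accessible_closed_set1/hausdorff_accessible/norm_hausdorff.
have clA : closed A.
  apply: closedI; last apply: closedI.
  - apply: (@preimage_closed _ _ (rnorm : B -> R) [set t | t <= r]).
      by move=> y _; exact: rnorm_continuous.
    exact: closed_le.
  - apply: closed0 => y; apply: cvgB; [exact: star_continuous|exact: cvg_id].
  - by apply: closed0 => y; apply: cvgB; apply: cstar_cvgM;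
      [exact: cvg_cst|exact: cvg_id|exact: cvg_id|exact: cvg_cst].
have [] :=
  @contraction_fixed_point _ (B : completeNormedModType R[i]) A f r clA.
- exists 0; split; first by rewrite /= rnorm0; case/andP: r01.
  split=> /=; last by rewrite mulr0 mul0r subrr.
  by rewrite star0 subrr.
- move=> y /AP[yr yy ay]; split; last split => /=.
  + rewrite /= /f rnormZr//.
    have := ler_rnormD (a * a) (y * y); rewrite ra => ?.
    have := rnormM y y; have := rnorm_ge0 y; rewrite /h.
    by case/andP: r01; nra.
  + by rewrite /f starZ conjc_real starD !starM aa yy subrr.
  + rewrite /f -scale_mulAr -scale_mulAl -scalerBr mulrDr mulrDl !mulrA.
    by rewrite ay -(mulrA y a y) ay mulrA subrr scaler0.
- exact: r01.
- move=> y z /AP[yr _ _] /AP[zr _ _].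
  rewrite /f -scalerBr rnormZr// opprD addrACA subrr add0r.
  rewrite -(subrKA (y * z)) -mulrBr -mulrBl.
  have := ler_rnormD (y * (y - z)) ((y - z) * z).
  have := rnormM y (y - z); have := rnormM (y - z) z.
  have := rnorm_ge0 (y - z).
  by rewrite /h; nra.
move=> y /AP[_ yy ay] fy; exists (1 - y); split.
- by rewrite starB star1 yy.
- by rewrite mulrBr mulrBl mulr1 mul1r ay.
have aaE : a * a = y + y - y * y.
  rewrite -[X in X + _ - _]fy -[X in _ + X - _]fy /f -scalerDl -rmorphD/=.
  have -> : h + h = 1 by rewrite /h; lra.
  by rewrite scale1r addrK.
suff -> : (1 - y) * (1 - y) = 1 - a * a by rewrite addrC subrK.
by rewrite aaE mulrBr mulr1 mulrBl mul1r -addrA -opprD [y + (y - _)]addrA.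
Qed.

End CstarAlgebra.

Section StarMorphism.
Context {R : realType} {B C : unitalCstarAlgType R}.

(** Continuity comes out of algebra: the norm of a self-adjoint contraction is
    controlled through the identity [a ^+ 2 + c ^+ 2 = 1], which every unital
    *-morphism preserves. *)
Lemma star_morphism_contractive (f : B -> C) :
  linear f -> monoid_morphism f -> {morph f : x / star x} ->
  forall x, rnorm (f x) <= rnorm x.
Proof.
move=> flin [f1 fM] fstar.
have fD x y : f (x + y) = f x + f y by rewrite -[x]scale1r flin !scale1r.
have f0 : f 0 = 0 by apply: (addrI (f 0)); rewrite -fD !addr0.
have fZ k x : f (k *: x) = k *: f x by rewrite -[k *: x]addr0 flin f0 addr0.
have unit_ball a : star a = a -> rnorm a < 1 -> rnorm (f a) <= 1.
  move=> aa /(cstar_complement_sqrt _ aa)[c [cc ac ac1]].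
  pose b := f a; pose d := f c; pose u := b + 'i%C *: d.
  have bb : star b = b by rewrite -fstar aa.
  have dd : star d = d by rewrite -fstar cc.
  have bd : b * d = d * b by rewrite -!fM ac.
  have bd1 : b * b + d * d = 1 by rewrite -!fM -fD ac1.
  have uE : star u = b - 'i%C *: d.
    rewrite starD starZ bb dd -scaleNr; congr (_ + _ *: _).
    by apply/eqP; rewrite eq_complex /= oppr0 !eqxx.
  (* The cross terms cancel because [b] and [d] commute. *)
  have uu : star u * u = 1.
    rewrite uE mulrDr !mulrBl -!scale_mulAl -!scale_mulAr -bd scalerA.
    rewrite (_ : 'i%C * 'i%C = -1) ?scaleN1r ?opprK ?subrKA//.
    by rewrite -expr2 sqr_i.
  (* The self-adjoint [b] is the real part of [u]. *)
  have bE : b = 2^-1%:C *: (u + star u).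
    rewrite uE addrACA subrr addr0 scalerDr -scalerDl -rmorphD/=.
    by rewrite (_ : 2^-1 + 2^-1 = 1 :> R) ?scale1r//; lra.
  rewrite -/b bE rnormZr ?invr_ge0//; have := ler_rnormD u (star u).
  by rewrite rnorm_star; have := rnorm_isometry_le1 _ uu; lra.
(* Rescale [a] by a real number [t] slightly larger than its norm. *)
have selfadjoint a : star a = a -> rnorm (f a) <= rnorm a.
  move=> aa; apply/ler_addgt0Pr => e e0.
  set t := rnorm a + e.
  have t0 : 0 < t by rewrite /t ltr_wpDl// rnorm_ge0.
  have ti0 : 0 <= t^-1 by rewrite invr_ge0 ltW.
  have := unit_ball (t^-1%:C *: a); rewrite fZ !rnormZr// starZ aa conjc_real.
  move=> /(_ erefl); rewrite !ler_pdivrMl// !ltr_pdivrMl// mulr1; apply.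
  by rewrite ltrDl.
move=> x; rewrite -(@ler_pXn2r _ 2) ?nnegrE ?rnorm_ge0//.
by rewrite -!rnorm_star_mul -fstar -fM selfadjoint// starM starK.
Qed.

End StarMorphism.

Lemma star_automorphism_isometric {R : realType} {B : unitalCstarAlgType R}
  (f : B -> B) : is_star_automorphism f -> forall x, rnorm (f x) = rnorm x.
Proof.
move=> [[g fK gK] flin fM fstar] x; apply/le_anti/andP; split.
  exact: star_morphism_contractive.
rewrite -{1}[x]fK; apply: (star_morphism_contractive g).
- by move=> k y z; apply: (can_inj fK); rewrite flin !gK.
- split; first by rewrite -{1}fM.1 fK.
  by move=> y z; apply: (can_inj fK); rewrite fM.2 !gK.
- by move=> y; apply: (can_inj fK); rewrite fstar !gK.
Qed.

(** * The trivial Banach bundle *)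

Lemma hausdorff_prod {U V : topologicalType} :
  hausdorff_space U -> hausdorff_space V -> hausdorff_space (U * V)%type.
Proof.
move=> hU hV [x y] [x' y'] clxy; congr pair.
  apply: hU => A A' xA xA'.
  have [||[z w] [/= Az A'z]] := clxy (fst @^-1` A) (fst @^-1` A').
  - exact: (@cvg_fst _ _ (nbhs x) (nbhs y)).
  - exact: (@cvg_fst _ _ (nbhs x') (nbhs y')).
  by exists z.
apply: hV => A A' yA yA'.
have [||[z w] [/= Aw A'w]] := clxy (snd @^-1` A) (snd @^-1` A').
- exact: (@cvg_snd _ _ (nbhs x) (nbhs y)).
- exact: (@cvg_snd _ _ (nbhs x') (nbhs y')).
by exists w.
Qed.

Lemma trivial_bundle_banach {R : realType} (G : topologicalGroupType)
  (B : unitalCstarAlgType R) :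
  hausdorff_space G -> locally_compact [set: G] ->
  is_banach_bundle (trivial_bundle G B).
Proof.
move=> hG lcG; split=> //.
- exact: hausdorff_prod hG (@norm_hausdorff _ B).
- by move=> p; exact: cvg_fst.
- by move=> U; exact: fst_open.
- by move=> x; exists (x, 0).
- move=> x; exists (cstar_banach B), (fun b => (x, b)); split => //.
  + split=> [b _ //|b c _ _ [] //|[y b] yx].
    by exists b => //; congr pair; exact: esym yx.
  + by move=> u; exact: rnormE.
- move=> p; apply: (cvg_comp (@snd G B) (@rnorm R B)); first exact: cvg_snd.
  exact: rnorm_continuous.
- apply: continuous_subspaceT => -[p q].
  apply: cvg_pair => /=.
    by apply: (cvg_comp (fun z : (G * B) * (G * B) => z.1) fst); exact: cvg_fst.
  apply: (@cvgD _ B).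
    apply: (cvg_comp (fun z : (G * B) * (G * B) => z.1) snd);
      [exact: cvg_fst|exact: cvg_snd].
  by apply: (cvg_comp (fun z : (G * B) * (G * B) => z.2) snd); exact: cvg_snd.
- move=> a p; apply: cvg_pair => /=; first exact: cvg_fst.
  by apply: (@cvgZr _ B); exact: cvg_snd.
- move=> I F s x FF s0 sx; rewrite /fzero/=.
  have -> : s = fun i => ((s i).1, (s i).2) by apply/funext => i; case: (s i).
  apply: cvg_pair => //; apply/cvg_rnorm0P => /=.
  under eq_fun do rewrite sub0r rnormN.
  exact: s0.
Qed.

(** * The twisted multiplication and involution *)

Section TwistedBundle.
Context {R : realType} {G : topologicalGroupType} {B : unitalCstarAlgType R}.
Context {S : G -> B -> B} {omega : G -> G -> B}.
Hypotheses (hS : cochain1 S) (homega : cochain2 omega).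
Hypothesis C1 : forall (g h : G) (b : B),
  S g (S h b) * omega g h = omega g h * S (g * h)%g b.
Hypothesis C2 : forall g h k : G,
  S g (omega h k) * omega g (h * k)%g = omega g h * omega (g * h)%g k.

Local Notation E := (trivial_bundle G B).
Local Notation mul := (twisted_mul S omega : E -> E -> E).
Local Notation inv := (twisted_inv S omega : E -> E).

Lemma cochain1M g b c : S g (b * c) = S g b * S g c.
Proof. by have [_ _ [_ ->]] := cochain1_aut hS g. Qed.

Lemma cochain1_unit g : S g 1 = 1.
Proof. by have [_ _ [-> _]] := cochain1_aut hS g. Qed.

Lemma cochain1D g b c : S g (b + c) = S g b + S g c.
Proof.
by have [_ lin _ _] := cochain1_aut hS g; rewrite -[b]scale1r lin !scale1r.
Qed.

Lemma cochain1Z g (k : R[i]) b : S g (k *: b) = k *: S g b.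
Proof.
have S0 : S g 0 = 0 by apply: (addrI (S g 0)); rewrite -cochain1D !addr0.
have [_ lin _ _] := cochain1_aut hS g.
by rewrite -[k *: b]addr0 lin S0 addr0.
Qed.

Lemma cochain1B g b c : S g (b - c) = S g b - S g c.
Proof. by rewrite cochain1D -scaleN1r cochain1Z scaleN1r. Qed.

Lemma cochain1_star g b : S g (star b) = star (S g b).
Proof. by have [_ _ _ ->] := cochain1_aut hS g. Qed.

Lemma rnorm_cochain1 g b : rnorm (S g b) = rnorm b.
Proof. exact: star_automorphism_isometric (cochain1_aut hS g) b. Qed.

(** Strong continuity gives joint continuity because the [S g] are uniformly
    bounded. *)
Lemma cvg_cochain1 {T : Type} {F : set_system T} {FF : Filter F}
  (f : T -> G) (k : T -> B) g b :
  f t @[t --> F] --> g -> k t @[t --> F] --> b ->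
  S (f t) (k t) @[t --> F] --> S g b.
Proof.
move=> fg kb; apply/cvg_rnorm0P.
apply: (@squeeze_cvgr _ _ _ _ (fun=> 0)
  (fun t => rnorm (S g b - S (f t) b) + rnorm (b - k t))).
- near=> t; rewrite rnorm_ge0/= -[rnorm (b - k t)](rnorm_cochain1 (f t)).
  rewrite cochain1B; exact: ler_rnorm_dist.
- exact: cvg_cst.
- rewrite -[0](addr0 0); apply: cvgD; last exact/cvg_rnorm0P.
  apply/(cvg_rnorm0P (fun t => S (f t) b)).
  exact: (cvg_comp f (fun g => S g b) fg (@cochain1_continuous _ _ _ _ hS b g)).
Unshelve. all: by end_near. Qed.

Lemma cvg_cochain2 {T : Type} {F : set_system T} {FF : Filter F}
  (f h : T -> G) g k :
  f t @[t --> F] --> g -> h t @[t --> F] --> k ->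
  omega (f t) (h t) @[t --> F] --> omega g k.
Proof.
move=> fg hk.
exact: (continuous2_cvg _ (@cochain2_continuous _ _ _ _ homega (g, k)) fg hk).
Qed.

Lemma cvg_mulg {T : Type} {F : set_system T} {FF : Filter F}
  (f h : T -> G) g k :
  f t @[t --> F] --> g -> h t @[t --> F] --> k ->
  (f t * h t)%g @[t --> F] --> (g * k)%g.
Proof.
by move=> fg hk; exact: (continuous2_cvg _ (@mulg_continuous G (g, k)) fg hk).
Qed.

Lemma cvg_invg {T : Type} {F : set_system T} {FF : Filter F} (f : T -> G) g :
  f t @[t --> F] --> g -> ((f t)^-1)%g @[t --> F] --> (g^-1)%g.
Proof. by move=> fg; exact: (cvg_comp _ _ fg (@invg_continuous G g)). Qed.

Lemma twisted_mul_continuous : continuous (fun p : E * E => mul p.1 p.2).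
Proof.
move=> [[g b] [h c]].
pose D := ((G * B) * (G * B))%type.
have c1 : (z : D).1.1 @[z --> ((g, b), (h, c))] --> g.
  by apply: (cvg_comp (fun z : D => z.1) fst); exact: cvg_fst.
have c2 : (z : D).1.2 @[z --> ((g, b), (h, c))] --> b.
  by apply: (cvg_comp (fun z : D => z.1) snd); [exact: cvg_fst|exact: cvg_snd].
have c3 : (z : D).2.1 @[z --> ((g, b), (h, c))] --> h.
  by apply: (cvg_comp (fun z : D => z.2) fst); [exact: cvg_snd|exact: cvg_fst].
have c4 : (z : D).2.2 @[z --> ((g, b), (h, c))] --> c.
  by apply: (cvg_comp (fun z : D => z.2) snd); exact: cvg_snd.
apply: cvg_pair; first exact: cvg_mulg.
apply: cstar_cvgM; last exact: cvg_cochain2.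
by apply: cstar_cvgM => //; exact: cvg_cochain1.
Qed.

Lemma twisted_inv_continuous : continuous inv.
Proof.
move=> [g b].
have c1 : (z : G * B).1 @[z --> (g, b)] --> g by exact: cvg_fst.
have c2 : (z : G * B).2 @[z --> (g, b)] --> b by exact: cvg_snd.
have starc (T : Type) (F : set_system T) (FF : Filter F) (f : T -> B) x :
    f t @[t --> F] --> x -> star (f t) @[t --> F] --> star x.
  by move=> fx; exact: (cvg_comp _ _ fx (star_continuous x)).
apply: cvg_pair; first exact: cvg_invg.
apply: cstar_cvgM; last first.
  by apply: cvg_cochain1; [exact: cvg_invg|exact: starc].
by apply: starc; apply: cvg_cochain2; [exact: cvg_invg|exact: c1].
Qed.

Lemma twisted_mulA : associative mul.
Proof.
move=> [g b] [h c] [k d]; rewrite /twisted_mul/= mulgA !cochain1M; congr pair.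
by rewrite -!mulrA C2 (mulrA _ (omega g h)) C1 !mulrA.
Qed.

Definition unit_fiber (b : B) : trivial_bundle G B := (1%g, b).
Definition unit_section (g : G) : trivial_bundle G B := (g, 1).

Local Notation emb := unit_fiber.
Local Notation u := unit_section.

Lemma twisted_mul1l p : mul (emb 1) p = p.
Proof.
case: p => g b; rewrite /twisted_mul/= mul1g (cochain1_one hS) mul1r.
by rewrite (cochain2_onel homega) mulr1.
Qed.

Lemma twisted_mul1r p : mul p (emb 1) = p.
Proof.
case: p => g b; rewrite /twisted_mul/= mulg1 cochain1_unit mulr1.
by rewrite (cochain2_oner homega) mulr1.
Qed.

Lemma twisted_embM b c : mul (emb b) (emb c) = emb (b * c).
Proof.
by rewrite /twisted_mul/= mulg1 (cochain1_one hS) (cochain2_oner homega) mulr1.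
Qed.

Lemma twisted_emb_u b g : mul (emb b) (u g) = (g, b).
Proof.
rewrite /twisted_mul/= mul1g (cochain1_one hS) (cochain2_onel homega).
by rewrite !mulr1.
Qed.

Lemma twisted_u_emb g b : mul (u g) (emb b) = mul (emb (S g b)) (u g).
Proof.
rewrite twisted_emb_u /twisted_mul/= mulg1 (cochain2_oner homega).
by rewrite mulr1 mul1r.
Qed.

Lemma twisted_uu g h : mul (u g) (u h) = mul (emb (omega g h)) (u (g * h)%g).
Proof. by rewrite twisted_emb_u /twisted_mul/= cochain1_unit !mul1r. Qed.

(** The case [(g, g^-1, g)] of the cocycle identity; it makes [inv (u g)] a
    right inverse of [u g] and not only a left one. *)
Lemma cochain2_inv g : S g (omega (g^-1)%g g) = omega g (g^-1)%g.
Proof.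
have := C2 g (g^-1)%g g.
by rewrite mulVg mulgV (cochain2_oner homega) (cochain2_onel homega) !mulr1.
Qed.

Lemma twisted_invE g b : inv (g, b) = mul (inv (u g)) (emb (star b)).
Proof.
rewrite /twisted_inv/twisted_mul/= mulg1 (cochain2_oner homega) mulr1.
by rewrite star1 cochain1_unit mulr1.
Qed.

Lemma twisted_invu_u g : mul (inv (u g)) (u g) = emb 1.
Proof.
rewrite /twisted_inv/twisted_mul/= mulVg star1 !cochain1_unit !mulr1.
by have [_ ->] := cochain2_unitary homega (g^-1)%g g.
Qed.

Lemma twisted_u_invu g : mul (u g) (inv (u g)) = emb 1.
Proof.
rewrite /twisted_inv/twisted_mul/= mulgV star1 cochain1_unit mulr1 mul1r.
rewrite cochain1_star cochain2_inv.
by have [_ ->] := cochain2_unitary homega g (g^-1)%g.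
Qed.

(** The rule [twisted_u_emb] multiplied by [inv (u g)] on both sides. *)
Lemma twisted_invu_emb g c :
  mul (inv (u g)) (emb (S g c)) = mul (emb c) (inv (u g)).
Proof.
rewrite -[LHS]twisted_mul1r -(twisted_u_invu g) !twisted_mulA.
by rewrite -(twisted_mulA _ _ (u g)) -twisted_u_emb twisted_mulA
  twisted_invu_u twisted_mul1l.
Qed.

(** Both sides are the inverse of [u g * u h = omega g h * u (g * h)]. *)
Lemma twisted_invu_invu g h :
  mul (inv (u h)) (inv (u g)) =
  mul (inv (u (g * h)%g)) (emb (star (omega g h))).
Proof.
have [_ ww] := cochain2_unitary homega g h.
have inv_uu : mul (mul (inv (u (g * h)%g)) (emb (star (omega g h))))
                  (mul (u g) (u h)) = emb 1.
  rewrite twisted_uu -!twisted_mulA (twisted_mulA (emb _) (emb _)).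
  by rewrite twisted_embM ww twisted_mul1l twisted_invu_u.
rewrite -[LHS]twisted_mul1l -inv_uu -!twisted_mulA.
rewrite (twisted_mulA (u h)) twisted_u_invu twisted_mul1l.
by rewrite twisted_u_invu twisted_mul1r.
Qed.

(** With [p = b u_g] and [q = c u_h], both sides equal
    [u_h^* c^* u_g^* b^*]. *)
Lemma twisted_invM p q : inv (mul p q) = mul (inv q) (inv p).
Proof.
case: p q => [g b] [h c]; rewrite {1}/twisted_mul /fst /snd.
rewrite (twisted_invE (g * h)%g) (twisted_invE g) (twisted_invE h).
rewrite !starM -!twisted_embM !twisted_mulA -twisted_invu_invu.
rewrite -cochain1_star -!twisted_mulA; congr mul.
by rewrite !twisted_mulA twisted_invu_emb.
Qed.

Lemma twisted_invK : involutive inv.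
Proof.
move=> [g b]; rewrite /twisted_inv/= invgK starM starK -cochain1_star starK.
rewrite cochain1M cochain2_inv C1 mulgV (cochain1_one hS) mulrA.
by have [_ ->] := cochain2_unitary homega g (g^-1)%g; rewrite mul1r.
Qed.

(** The product [inv s * s] has the form [star c * c] inside [B]; this gives at
    once its norm and its positivity. *)
Lemma twisted_inv_mul g b :
  mul (inv (g, b)) (g, b) =
  let c := S (g^-1)%g b * omega (g^-1)%g g in emb (star c * c).
Proof.
by rewrite /twisted_inv/twisted_mul/= mulVg starM cochain1_star !mulrA.
Qed.

Lemma twisted_inv_emb b : inv (emb b) = emb (star b).
Proof.
by rewrite /twisted_inv/= invg1 (cochain1_one hS) (cochain2_oner homega)
  star1 mul1r.
Qed.

Lemma twisted_fell_bundle :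
  hausdorff_space G -> locally_compact [set: G] ->
  is_fell_bundle (twisted_mul S omega) (twisted_inv S omega).
Proof.
move=> hG lcG; split => //.
- exact: trivial_bundle_banach.
- exact: twisted_mul_continuous.
- exact: twisted_mulA.
- exact: twisted_inv_continuous.
- move=> [g b] [h b'] [k c] /= gh; rewrite /bproj/= in gh; rewrite -gh.
  by rewrite /twisted_mul/= !mulrDl.
- move=> [g b] [h c] [k c'] /= gh; rewrite /bproj/= in gh; rewrite -gh.
  by rewrite /twisted_mul/= cochain1D mulrDr mulrDl.
- by move=> k [g b] [h c]; rewrite /twisted_mul/= /fscale/= !scale_mulAl.
- move=> k [g b] [h c]; rewrite /twisted_mul/= /fscale/= cochain1Z.
  by rewrite scale_mulAl scale_mulAr.
- move=> [g b] [h c].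
  change (rnorm (b * S g c * omega g h) <= rnorm b * rnorm c).
  rewrite rnorm_mul_unitary; last exact: cochain2_unitary.
  by rewrite -(rnorm_cochain1 g c) rnormM.
- move=> [g b] [h c] /= gh; rewrite /bproj/= in gh; rewrite -gh.
  by rewrite /twisted_inv/= starD cochain1D mulrDr.
- move=> k [g b]; rewrite /twisted_inv/= /fscale/= starZ cochain1Z.
  by rewrite scale_mulAr.
- exact: twisted_invM.
- exact: twisted_invK.
- move=> [g b]; rewrite twisted_inv_mul.
  change (rnorm (star (S (g^-1)%g b * omega (g^-1)%g g) *
    (S (g^-1)%g b * omega (g^-1)%g g)) = rnorm b ^+ 2).
  rewrite rnorm_star_mul rnorm_mul_unitary ?rnorm_cochain1//.
  exact: cochain2_unitary.
- move=> [g b]; exists (emb (S (g^-1)%g b * omega (g^-1)%g g)) => //.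
  by rewrite twisted_inv_mul twisted_inv_emb twisted_embM.
Qed.

End TwistedBundle.

Theorem theorem5p6 (R : realType) (G : topologicalGroupType)
  (B : unitalCstarAlgType R) (S : G -> B -> B) (omega : G -> G -> B)
  (hausdorffG : hausdorff_space G) (loccompG : locally_compact [set: G])
  (hS : cochain1 S) (homega : cochain2 omega)
  (C1 : forall (g h : G) (b : B),
      S g (S h b) * omega g h = omega g h * S (g * h)%g b)
  (C2 : forall g h k : G,
      S g (omega h k) * omega g (h * k)%g = omega g h * omega (g * h)%g k) :
  is_crossed_product_bundle (twisted_mul S omega) (twisted_inv S omega).
Proof.
split; first exact: twisted_fell_bundle.
exists (unit_fiber 1).
  by split=> // s _; rewrite (twisted_mul1l hS homega) (twisted_mul1r hS homega).
move=> g; exists (unit_section g) => //.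
by rewrite (twisted_u_invu hS homega C2) (twisted_invu_u hS homega).
Qed.
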